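(* Let $m\ge1$, $0\le r\le n$ be integers and let $p$ be $0$ or a prime. Let $A_1,\dots,A_m\subseteq[n]$, and set $E=\bigcup_{i=1}^m\{i\}\times A_i\subseteq[m]\times[n]$. Then $E$ is independent in $\mathrm{T}_{m,n}(1,r,p)$ if and only if both of the following hold: \begin{align*} |A_i\cap A_j| &= 0 && \text{for all distinct } i,j\in[m],\\ \sum_{i=1}^m|A_i| &\le r. \end{align*}
   Context: Write $[n]=\{1,\dots,n\}$. For integers $0\le s\le m$, $0\le r\le n$ and $p$ equal to $0$ or a prime, the tensor matroid $\mathrm{T}_{m,n}(s,r,p)$ is the following matroid on $[m]\times[n]$. Let $K$ be a field of characteristic $p$ and let $u_1,\dots,u_m\in K^s$, $v_1,\dots,v_n\in K^r$ be vectors all of whose coordinates together are algebraically independent over the prime field. A set $E\subseteq[m]\times[n]$ is independent if and only if the vectors $u_i\otimes v_j$, indexed by $(i,j)\in E$, are linearly independent in $K^s\otimes K^r$. This matroid depends only on $m,n,s,r,p$. *)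

(* Defs.v *)
From HB Require Import structures.
From mathcomp Require Import all_boot all_order all_algebra.
From mathcomp Require Import fraction mxtens mpoly.

Set Implicit Arguments.
Unset Strict Implicit.
Unset Printing Implicit Defensive.

Import GRing.Theory.
Local Open Scope ring_scope.

Definition has_characteristic (p : nat) (K : fieldType) : Prop :=
  if p == 0%N then [pchar K] =i pred0 else p \in [pchar K].

(* The prime field: the intersection of all subfields of K. *)
Definition in_prime_field (K : fieldType) (x : K) : Prop :=
  forall S : divringClosed K, x \in S.

Definition algebraically_independent (K : fieldType) (N : nat)
    (x : 'I_N -> K) : Prop :=
  forall P : {mpoly K[N]},
    (forall k : 'X_{1..N}, in_prime_field P@_k) -> P.@[x] = 0 -> P = 0.

(* The m * s + n * r coordinates of u_1, ..., u_m, v_1, ..., v_n, as one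
   family (repetitions matter). *)
Definition all_coordinates (K : fieldType) (m n s r : nat)
    (u : 'I_m -> 'rV[K]_s) (v : 'I_n -> 'rV[K]_r) : 'I_(m * s + n * r) -> K :=
  row_mx (mxvec (\matrix_i u i)) (mxvec (\matrix_j v j)) 0.

(* The data (K, u, v) used to define T_{m,n}(s,r,p). *)
Definition tensor_realization (p : nat) (K : fieldType) (m n s r : nat)
    (u : 'I_m -> 'rV[K]_s) (v : 'I_n -> 'rV[K]_r) : Prop :=
  has_characteristic p K /\ algebraically_independent (all_coordinates u v).

(* The independent sets of T_{m,n}(s,r,p) when tensor_realization p u v holds.
   The Kronecker product *t identifies K^s (x) K^r with K^(s * r).  Since free
   is applied to the family (not the set) of the tensors u_i (x) v_j, a
   repeated tensor makes E dependent. *)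
Definition tensor_matroid (K : fieldType) (m n s r : nat)
    (u : 'I_m -> 'rV[K]_s) (v : 'I_n -> 'rV[K]_r) : {set {set 'I_m * 'I_n}} :=
  [set E : {set 'I_m * 'I_n} | free [seq u e.1 *t v e.2 | e in E]].

(* The rest of the file shows that realizations exist for every m, n, s, r and
   every p that is 0 or prime, so that a statement about all realizations is
   never vacuous. *)
Section Existence.

Variables (F : fieldType) (N : nat).
Let K : fieldType := {fraction {mpoly F[N]}}.
Let inF (c : F) : K := tofrac (mpolyC N c).

Let inF_zmod : zmod_morphism inF.
Proof. by move=> a b; rewrite /inF mpolyCB tofracB. Qed.
Let inF_monoid : monoid_morphism inF.
Proof. by split=> [|a b]; rewrite /inF ?mpolyC1 ?tofrac1 // mpolyCM tofracM. Qed.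
#[local] HB.instance Definition _ := GRing.isZmodMorphism.Build F K inF inF_zmod.
#[local] HB.instance Definition _ :=
  GRing.isMonoidMorphism.Build F K inF inF_monoid.

Let outF (x : K) : F :=
  let d := \d_(repr x) in (\n_(repr x))@_(mlead d) / d@_(mlead d).

Let inFK : cancel inF outF.
Proof.
move=> c; rewrite /outF; set y := repr _.
have : equivf (Ratio (mpolyC N c) 1) y.
  apply/eqmodP; rewrite /y reprK /inF.
  by rewrite /FracField.tofrac -lock.
rewrite FracField.equivfE !numden_Ratio ?oner_neq0 // mul1r => /eqP <-.
rewrite mcoeffCM mulfK // -/(mleadc _) mleadc_eq0.
exact: denom_ratioP.
Qed.

Let constF : {pred K} := [pred x | x == inF (outF x)].

Let constFP x : reflect (exists c, x = inF c) (x \in constF).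
Proof.
by apply: (iffP eqP) => [->|[c ->]]; [exists (outF x) | rewrite inFK].
Qed.

Let constF_divring : divring_closed constF.
Proof.
split; first by apply/constFP; exists 1; rewrite rmorph1.
  move=> _ _ /constFP[a ->] /constFP[b ->].
  by apply/constFP; exists (a - b); rewrite rmorphB.
move=> _ _ /constFP[a ->] /constFP[b ->].
by apply/constFP; exists (a / b); rewrite fmorph_div.
Qed.
#[local] HB.instance Definition _ :=
  GRing.isDivringClosed.Build K constF constF_divring.

Let indeterminate (i : 'I_N) : K := tofrac 'X_i.

Lemma indeterminates_independent : algebraically_independent indeterminate.
Proof.
move=> P Pprime P0.
have PF k : P@_k = inF (outF P@_k) by apply/eqP; exact: (Pprime k constF).
pose Q : {mpoly F[N]} := \sum_(k <- msupp P) outF P@_k *: 'X_[k].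
have Q0 : Q = 0.
  apply/eqP; rewrite -tofrac_eq0 -P0 mevalE /Q rmorph_sum; apply/eqP.
  apply: eq_bigr => k _; rewrite {2}PF -mul_mpolyC rmorphM; congr (_ * _).
  rewrite mpolyXE_id rmorph_prod; apply: eq_bigr => i _.
  by rewrite rmorphXn.
apply/mpolyP => k; rewrite mcoeff0.
have [kP|/memN_msupp_eq0 //] := boolP (k \in msupp P).
have /(congr1 (mcoeff k)) := Q0.
rewrite /Q raddf_sum mcoeff0 /= (bigD1_seq k) ?msupp_uniq //=.
rewrite big1 => [|j /negPf jk]; last by rewrite mcoeffZ mcoeffX jk mulr0.
by rewrite mcoeffZ mcoeffX eqxx mulr1 addr0 => Pk0; rewrite PF Pk0 rmorph0.
Qed.

Lemma fraction_pchar : [pchar K] =i [pchar F].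
Proof. exact: (fmorph_pchar inF). Qed.

End Existence.

Lemma tensor_realization_exists (m n s r p : nat) : p = 0%N \/ prime p ->
  exists (K : fieldType) (u : 'I_m -> 'rV[K]_s) (v : 'I_n -> 'rV[K]_r),
    tensor_realization p u v.
Proof.
move=> p0_or_prime.
have [F charF] : exists F : fieldType, has_characteristic p F.
  case: p0_or_prime => [->|p_pr]; first by exists rat; exact: Num.Theory.pchar_num.
  exists 'F_p; rewrite /has_characteristic ifN; last by case: p p_pr.
  exact: pchar_Fp.
pose N := (m * s + n * r)%N; pose K : fieldType := {fraction {mpoly F[N]}}.
pose x : 'rV[K]_N := \row_i tofrac 'X_i.
exists K, (fun i => row i (vec_mx (lsubmx x))),
  (fun j => row j (vec_mx (rsubmx x))); split.
  move: charF; rewrite /has_characteristic; case: ifP => _ charF.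
    by move=> q; rewrite fraction_pchar charF.
  by rewrite fraction_pchar.
move=> P Pprime P0; apply: indeterminates_independent => //.
rewrite -[RHS]P0; apply: meval_eq => i; rewrite /all_coordinates.
have rowsK a b (A : 'M[K]_(a, b)) : \matrix_i row i A = A.
  by apply/matrixP => j k; rewrite !mxE.
by rewrite !rowsK !vec_mxK hsubmxK mxE.
Qed.

(* Main.v *)
(** Since u_i and v_j are generic, every u_i is a nonzero scalar and any k <= r
    of the v_j are linearly independent: a k x k minor of the matrix of the v_j
    is the value of a determinant polynomial with coefficients in the prime
    field, which is nonzero because it specializes to the determinant of the
    identity matrix.  Up to nonzero scalars the tensors u_i (x) v_j are the v_j,
    so E is independent iff no column index is repeated and |E| <= r. *)
Require Import Defs.
From mathcomp Require Import all_boot all_order all_algebra.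
From mathcomp Require Import mxtens mpoly.

Section RankOne.

Set Implicit Arguments.
Unset Strict Implicit.
Unset Printing Implicit Defensive.

Import GRing.Theory.
Local Open Scope ring_scope.

(** Transports [freeP] along the enumeration of [A], so that coefficients are indexed by cells
    instead of ordinals. *)
Lemma free_imageP (K : fieldType) (V : vectType K) (T : finType)
    (A : {set T}) (f : T -> V) :
  free [seq f x | x in A] <->
  (forall c : T -> K, \sum_(x in A) c x *: f x = 0 ->
     {in A, forall x, c x = 0}).
Proof.
have szA : size [seq f x | x in A] == #|A| by rewrite size_image.
pose X := Tuple szA; rewrite -[X in free X]/(tval X).
have nthX (i : 'I_#|A|) : X`_i = f (enum_val i) by rewrite /= nth_image.
split=> [/freeP freeX c sum0 x xA | indep].
  have /freeX/(_ (enum_rank_in xA x)) :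
      \sum_i c (enum_val i) *: X`_(i : 'I_#|A|) = 0.
    rewrite -[RHS]sum0 [RHS]big_enum_val /=.
    by apply: eq_bigr => i _; rewrite nthX.
  by rewrite enum_rankK_in.
apply/freeP => k sum0 i.
(* [xA] only witnesses that [A] is nonempty; off [A], [c] takes a default value that the sum never
   sees. *)
have xA := enum_valP i; pose c x := k (enum_rank_in xA x).
suff : c (enum_val i) = 0 by rewrite /c enum_valK_in.
apply: indep => //; rewrite big_enum_val /= -[RHS]sum0.
by apply: eq_bigr => j _; rewrite nthX /c enum_valK_in.
Qed.

(** Makes all tensors in one column multiples of a single vector. *)
Lemma tens_rowE (K : fieldType) (r : nat) (a : 'rV[K]_1) (b : 'rV[K]_r) :
  a *t b = a 0 0 *: (1%:M *t b).
Proof. by apply/matrixP => i j; rewrite !mxE !ord1 /= mul1r. Qed.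

(** Otherwise the coordinate would be a root of a single indeterminate, a nonzero polynomial over
    the prime field. *)
Lemma left_coordinate_neq0 (K : fieldType) (m n s r : nat)
    (u : 'I_m -> 'rV[K]_s) (v : 'I_n -> 'rV[K]_r)
    (indep : algebraically_independent (all_coordinates u v))
    (i : 'I_m) (l : 'I_s) : u i 0 l != 0.
Proof.
pose w : 'I_(m * s + n * r) := lshift _ (mxvec_index i l).
apply/eqP => ui0; suff /(congr1 (mcoeff U_(w))) : 'X_w = 0 :> {mpoly K[_]}.
  by rewrite mcoeffX eqxx mcoeff0 => /eqP; rewrite oner_eq0.
apply: indep => [k S|]; first by apply/mpolyOverP: k; apply: mpolyOverX.
by rewrite mevalXU /all_coordinates row_mxEl mxvecE mxE.
Qed.

Lemma right_minor_neq0 (K : fieldType) (m n s r k : nat)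
    (u : 'I_m -> 'rV[K]_s) (v : 'I_n -> 'rV[K]_r)
    (indep : algebraically_independent (all_coordinates u v))
    (f : 'I_k -> 'I_n) (g : 'I_k -> 'I_r) :
  injective f -> injective g -> \det (\matrix_(a, b) v (f a) 0 (g b)) != 0.
Proof.
move=> f_inj g_inj.
pose w j l : 'I_(m * s + n * r) := rshift _ (mxvec_index j l).
pose M : 'M[{mpoly K[m * s + n * r]}]_k := \matrix_(a, b) 'X_(w (f a) (g b)).
have evalM x : (\det M).@[x] = \det (\matrix_(a, b) x (w (f a) (g b))).
  rewrite -det_map_mx; congr (\det _); apply/matrixP => a b.
  by rewrite !mxE /= mevalXU.
apply/eqP => det0; have /(congr1 (meval _)) M0 : \det M = 0.
  apply: indep => [h S|].
    (* By the Leibniz expansion, the coefficients lie in every subfield [S]. *)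
    apply/mpolyOverP: h; apply: rpred_sum => sg _.
    rewrite rpredM ?rpredX ?rpredN ?rpred1 // rpred_prod // => a _.
    by rewrite mxE mpolyOverX.
  rewrite evalM -[RHS]det0; congr (\det _); apply/matrixP => a b.
  by rewrite !mxE /all_coordinates row_mxEr mxvecE mxE.
(* The specialization sends row [f a] to the unit vector at [g a]. As [f] and [g] are injective, the
   minor becomes the identity; the coordinates of [u] do not occur in it and are set to 0. *)
pose y : 'rV[K]_(m * s + n * r) :=
  row_mx 0 (mxvec (\matrix_(j, l) [exists a, (f a == j) && (g a == l)]%:R)).
have := M0 (y 0); rewrite evalM meval0 => /eqP.
rewrite [X in \det X](_ : _ = 1%:M) ?det1 ?oner_eq0 //.
apply/matrixP => a b; rewrite mxE [RHS]mxE row_mxEr mxvecE mxE.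
congr (_%:R); congr nat_of_bool; apply/existsP/eqP => [[c /andP[]] | <-].
  by move=> /eqP/f_inj -> /eqP/g_inj.
by exists a; rewrite !eqxx.
Qed.

Lemma tensor_matroid_rank1 (K : fieldType) (m n r : nat)
    (u : 'I_m -> 'rV[K]_1) (v : 'I_n -> 'rV[K]_r)
    (indep : algebraically_independent (all_coordinates u v))
    (E : {set 'I_m * 'I_n}) :
  E \in tensor_matroid u v <->
  {in E &, injective snd} /\ (#|E| <= r)%N.
Proof.
rewrite inE; split=> [freeE | [snd_inj leEr]].
  split; last first.
    move: freeE; rewrite /free size_image => /eqP <-.
    by rewrite (leq_trans (dimvS (subvf _))) // dimvf /dim /= !mul1n.
  move=> [i j] [i' j'] iE i'E /= jj'; rewrite -jj' {j' jj'} in i'E *.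
  apply/eqP; rewrite xpair_eqE eqxx andbT; apply: contraT => neq_ii'.
  (* Two cells in column [j] satisfy the relation $u_{i'}(u_i\otimes v_j)-u_i(u_{i'}\otimes v_j)=0$,
     whose first coefficient is nonzero. *)
  pose c e := if e == (i, j) then u i' 0 0
              else if e == (i', j) then - u i 0 0 else 0.
  have /free_imageP/(_ c) := freeE.
  have ne : (i', j) != (i, j) by rewrite xpair_eqE eqxx andbT eq_sym.
  rewrite (bigD1 (i, j)) //= (bigD1 (i', j)) /=; last by rewrite i'E.
  rewrite big1 => [|e /andP[/andP[_ /negPf e1] /negPf e2]]; last first.
    by rewrite /c e1 e2 scale0r.
  rewrite /c eqxx (negPf ne) eqxx addr0 (tens_rowE (u i)) (tens_rowE (u i')).
  rewrite !scalerA -scalerDl mulNr mulrC subrr scale0r => /(_ erefl) /(_ _ iE).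
  by rewrite eqxx => /eqP; rewrite (negPf (left_coordinate_neq0 indep i' _)).
apply/free_imageP => c sum0.
pose f (a : 'I_#|E|) := (enum_val a).2.
(* Keeping the first [#|E|] of the [r] coordinates gives a square minor; its rows are distinct $v_j$
   because [snd] is injective on [E]. *)
pose M := \matrix_(a, b) v (f a) 0 (widen_ord leEr b).
have unitM : M \in unitmx.
  rewrite unitmxE unitfE; apply: (right_minor_neq0 indep) => a b.
    by move=> /(snd_inj _ _ (enum_valP a) (enum_valP b))/enum_val_inj.
  by move=> /(congr1 val) /= /val_inj.
(* Absorbing the scalars $u_i$ into the coefficients turns the tensor relation into [d *m M = 0]. *)
pose d := \row_(a < #|E|) (c (enum_val a) * u (enum_val a).1 0 0).
have /(congr1 (mulmx^~ (invmx M))) : d *m M = 0.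
  apply/rowP => b; rewrite !mxE.
  have /matrixP/(_ 0 (mxtens_index (0, widen_ord leEr b))) := sum0.
  rewrite summxE mxE big_enum_val => sum_b; rewrite -[RHS]sum_b.
  by apply: eq_bigr => a _; rewrite !mxE mxtens_indexK /= mulrA !ord1.
rewrite mulmxK // mul0mx => /rowP d0 e eE.
have := d0 (enum_rank_in eE e); rewrite !mxE enum_rankK_in // => /eqP.
by rewrite mulf_eq0 (negPf (left_coordinate_neq0 indep _ _)) orbF => /eqP.
Qed.

End RankOne.

Theorem corollary3p2 (m n r p : nat) (hm : 1 <= m) (hr : r <= n)
    (hp : p = 0 \/ prime p)
    (K : fieldType) (u : 'I_m -> 'rV[K]_1) (v : 'I_n -> 'rV[K]_r)
    (huv : tensor_realization p u v)
    (A : 'I_m -> {set 'I_n}) :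
  \bigcup_(i < m) setX [set i] (A i) \in tensor_matroid u v
  <->
  (forall i j : 'I_m, i != j -> #|A i :&: A j| = 0) /\
  \sum_(i < m) #|A i| <= r.
Proof.
case: huv => _ /tensor_matroid_rank1 ->; set E := \bigcup_(i < m) _.
have inE2 i j : ((i, j) \in E) = (j \in A i).
  apply/bigcupP/idP => [[i' _]|jA].
    by rewrite in_setX in_set1 => /andP[/eqP <-].
  by exists i; rewrite // in_setX in_set1 eqxx.
have -> : #|E| = \sum_(i < m) #|A i|.
  under eq_bigr do rewrite -sum1_card.
  rewrite pair_big_dep -sum1_card; apply: eq_bigl => -[i j] /=.
  exact: inE2.
(* Two distinct cells of [E] in column [j] are the same as an element [j] common to two of the sets
   [A i]. *)
suff -> : {in E &, injective snd} <->
  (forall i j : 'I_m, i != j -> #|A i :&: A j| = 0) by [].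
split=> [inj i i' neq | disj [i j] [i' j'] /=].
  apply: eq_card0 => j; rewrite !inE; apply/negbTE/negP => /andP[ji ji'].
  have [] : (i, j) = (i', j) by apply: inj; rewrite ?inE2.
  move=> eq_ii'.
  by rewrite eq_ii' eqxx in neq.
rewrite !inE2 => jA + jj'; rewrite -jj' => jA'.
have [-> // | /disj/eqP] := eqVneq i i'.
by rewrite cards_eq0 => /eqP/setP/(_ j); rewrite !inE jA jA'.
Qed.
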